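(* Let $p,q\ge 1$, let $\bm{x}^e=\mathbf{F}^e/W^e:[0,1]^2\to\mathbb{R}^3$ be a rational Bézier element of bi-degree $(p,q)$ with Jacobian matrix $\bm{\mathcal{J}}^e=[\bm{x}^e_\xi\ \ \bm{x}^e_\eta]$, and assume that $W^e(\xi,\eta)>0$ on $[0,1]^2$. Let $D^e_{rs}$ ($0\le r\le 8p-2$, $0\le s\le 8q-2$) be the Bernstein coefficients of the numerator $N^e$ of the Gram determinant of $\bm{x}^e$. If $D^e_{rs}\ge 0$ for all $(r,s)$ and $D^e_{rs}>0$ for at least one $(r,s)$, then $$\det\!\big((\bm{\mathcal{J}}^e)^\top\bm{\mathcal{J}}^e\big)(\xi,\eta)>0\qquad\text{for all }(\xi,\eta)\in(0,1)^2.$$ Consequently, $\bm{\mathcal{J}}^e(\xi,\eta)$ has full column rank for every $(\xi,\eta)\in(0,1)^2$, i.e. the parametrization $\bm{x}^e$ is regular on $(0,1)^2$.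
   Context: $B_i^n(t)=\binom{n}{i}t^i(1-t)^{n-i}$, $0\le i\le n$, denote the Bernstein polynomials of degree $n$. A rational Bézier element of bi-degree $(p,q)$ is a map $\bm{x}^e=\mathbf{F}^e/W^e$ on $[0,1]^2$, where $\mathbf{F}^e$ is an $\mathbb{R}^3$-valued and $W^e$ a real-valued linear combination of the products $B_i^p(\xi)B_j^q(\eta)$, $0\le i\le p$, $0\le j\le q$. Put $\mathbf{U}^e=\mathbf{F}^e_\xi W^e-\mathbf{F}^eW^e_\xi$ and $\mathbf{V}^e=\mathbf{F}^e_\eta W^e-\mathbf{F}^eW^e_\eta$ (subscripts $\xi,\eta$ are partial derivatives), so that $\bm{\mathcal{J}}^e=(W^e)^{-2}[\mathbf{U}^e\ \ \mathbf{V}^e]$. The numerator of the Gram determinant is the polynomial $$N^e=(\mathbf{U}^e\cdot\mathbf{U}^e)(\mathbf{V}^e\cdot\mathbf{V}^e)-(\mathbf{U}^e\cdot\mathbf{V}^e)^2,$$ so that $\det((\bm{\mathcal{J}}^e)^\top\bm{\mathcal{J}}^e)=N^e/(W^e)^8$. It has degree at most $8p-2$ in $\xi$ and at most $8q-2$ in $\eta$, and its Bernstein coefficients $D^e_{rs}$ are defined by $N^e(\xi,\eta)=\sum_{r=0}^{8p-2}\sum_{s=0}^{8q-2}D^e_{rs}B_r^{8p-2}(\xi)B_s^{8q-2}(\eta)$. A parametrization is called regular on a set if its Jacobian matrix has full column rank (rank $2$) at every point of that set. *)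

(* Defs.v *)
From HB Require Import structures.
From mathcomp Require Import all_boot all_order all_algebra.
From mathcomp Require Import all_classical all_reals all_analysis.

Set Implicit Arguments.
Unset Strict Implicit.
Unset Printing Implicit Defensive.

Import Order.TTheory GRing.Theory Num.Theory.
Import numFieldNormedType.Exports.

Local Open Scope classical_set_scope.
Local Open Scope ring_scope.

Section RationalBezier.
Variable R : realType.

Definition bernstein (n i : nat) (t : R) : R :=
  t ^+ i * (1 - t) ^+ (n - i) *+ 'C(n, i).

Definition bernstein_comb (m n : nat) (c : 'M[R]_(m.+1, n.+1))
    (xi eta : R) : R :=
  \sum_(i < m.+1) \sum_(j < n.+1) c i j * (bernstein m i xi * bernstein n j eta).

Definition bernstein_vcomb (m n : nat) (c : 'I_m.+1 -> 'I_n.+1 -> 'cV[R]_3)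
    (xi eta : R) : 'cV[R]_3 :=
  \sum_(i < m.+1) \sum_(j < n.+1)
    (bernstein m i xi * bernstein n j eta) *: c i j.

Definition partial_xi (V : normedModType R) (f : R -> R -> V) (xi eta : R) : V :=
  derive1 (fun t => f t eta) xi.

Definition partial_eta (V : normedModType R) (f : R -> R -> V) (xi eta : R) : V :=
  derive1 (fun t => f xi t) eta.

Definition jacobian_mx (x : R -> R -> 'cV[R]_3) (xi eta : R) : 'M[R]_(3, 1 + 1) :=
  row_mx (partial_xi x xi eta) (partial_eta x xi eta).

Definition gram_det (x : R -> R -> 'cV[R]_3) (xi eta : R) : R :=
  \det ((jacobian_mx x xi eta)^T *m jacobian_mx x xi eta).

Definition regular_on (A : set (R * R)) (x : R -> R -> 'cV[R]_3) : Prop :=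
  forall z, A z -> \rank (jacobian_mx x z.1 z.2) = 2%N.

Definition rational_map (F : R -> R -> 'cV[R]_3) (W : R -> R -> R)
    (xi eta : R) : 'cV[R]_3 :=
  (W xi eta)^-1 *: F xi eta.

Definition dot (u v : 'cV[R]_3) : R := \sum_(k < 3) u k 0 * v k 0.

Definition gram_U (F : R -> R -> 'cV[R]_3) (W : R -> R -> R)
    (xi eta : R) : 'cV[R]_3 :=
  W xi eta *: partial_xi F xi eta - partial_xi W xi eta *: F xi eta.

Definition gram_V (F : R -> R -> 'cV[R]_3) (W : R -> R -> R)
    (xi eta : R) : 'cV[R]_3 :=
  W xi eta *: partial_eta F xi eta - partial_eta W xi eta *: F xi eta.

Definition gram_numerator (F : R -> R -> 'cV[R]_3) (W : R -> R -> R)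
    (xi eta : R) : R :=
  let U := gram_U F W xi eta in
  let V := gram_V F W xi eta in
  dot U U * dot V V - dot U V ^+ 2.

(* For a polynomial function f of degree at most m in xi and n in eta, such a D
   exists and is unique. *)
Definition bernstein_coefs (m n : nat) (f : R -> R -> R)
    (D : 'M[R]_(m.+1, n.+1)) : Prop :=
  forall xi eta : R, xi \in `[0, 1] -> eta \in `[0, 1] ->
    f xi eta = bernstein_comb D xi eta.

End RationalBezier.

(* Main.v *)
Require Import Defs.
From HB Require Import structures.
From mathcomp Require Import all_boot all_order all_algebra.
From mathcomp Require Import all_classical all_reals all_analysis.
From mathcomp Require Import ring.
Set Implicit Arguments.
Unset Strict Implicit.
Unset Printing Implicit Defensive.
Import Order.TTheory GRing.Theory Num.Theory.
Import numFieldNormedType.Exports.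
Local Open Scope classical_set_scope.
Local Open Scope ring_scope.

(** The Gram determinant and the numerator [gram_numerator] differ by a power
    of the weight.  By the quotient rule the two columns of the Jacobian matrix
    of [F / W] are [W^-2 *: U] and [W^-2 *: V] ([derive1_rational]); the Gram
    determinant of two vectors is homogeneous of degree two in each of them, so
    it equals [W^-8 * N] ([gram_det_rational]), and [W > 0] leaves only the
    sign of [N] to be studied.

    On the open square every product of Bernstein polynomials is strictly
    positive.  A combination of them with nonnegative coefficients, one of
    which is positive, is therefore positive ([bernstein_comb_gt0]): the term
    of that coefficient cannot be compensated.  On the boundary of the square
    the products may vanish, which is why the conclusion is confined to the
    interior.

    Finally a positive, hence nonzero, Gram determinant makes [J^T *m J]
    invertible, and a product cannot have a larger rank than its right factor,
    so that [J] has rank two ([rank_gram]). *)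

(** * Positivity of Bernstein combinations *)

Lemma bernstein_gt0 (R : realType) (n i : nat) (t : R) :
  (i <= n)%N -> 0 < t < 1 -> 0 < bernstein n i t.
Proof.
move=> le_in /andP[t_gt0 t_lt1]; rewrite /bernstein pmulrn_lgt0 ?bin_gt0 //.
by rewrite mulr_gt0 // exprn_gt0 // subr_gt0.
Qed.

Lemma bernstein_comb_gt0 (R : realType) (m n : nat) (D : 'M[R]_(m.+1, n.+1))
    (xi eta : R) :
  0 < xi < 1 -> 0 < eta < 1 ->
  (forall r s, 0 <= D r s) -> (exists r s, 0 < D r s) ->
  0 < bernstein_comb D xi eta.
Proof.
move=> xi01 eta01 D_ge0 [r [s Drs_gt0]].
have B_gt0 (i : 'I_m.+1) (j : 'I_n.+1) :
    0 < bernstein m i xi * bernstein n j eta.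
  by rewrite mulr_gt0 // bernstein_gt0 // -ltnS.
have term_ge0 i j : 0 <= D i j * (bernstein m i xi * bernstein n j eta).
  by rewrite mulr_ge0 // ltW.
rewrite /bernstein_comb (bigD1 r) //=; apply: ltr_wpDr.
  by apply: sumr_ge0 => i _; apply: sumr_ge0 => j _.
rewrite (bigD1 s) //=; apply: ltr_wpDr; last by rewrite mulr_gt0.
by apply: sumr_ge0 => j _.
Qed.

(** * Differentiability of Bernstein combinations *)

Lemma derivable_bernstein (R : realType) (n i : nat) (t : R) :
  derivable (bernstein n i) t 1.
Proof.
have -> : bernstein n i
    = horner ('X^i * (1 - 'X) ^+ (n - i) *+ 'C(n, i)) :> (R -> R).
  by apply/funext => s; rewrite /bernstein hornerMn !hornerE.
exact: derivable_horner.
Qed.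

Lemma derivable_bernstein_comb_xi (R : realType) (m n : nat)
    (c : 'M[R]_(m.+1, n.+1)) (xi eta : R) :
  derivable (fun t => bernstein_comb c t eta) xi 1.
Proof.
have -> : (fun t => bernstein_comb c t eta) = \sum_(i < m.+1)
    ((\sum_(j < n.+1) c i j * bernstein n j eta) \*: bernstein m i).
  apply/funext => t; rewrite fct_sumE; apply: eq_bigr => i _.
  rewrite [RHS]mulr_suml; apply: eq_bigr => j _; ring.
by apply: derivable_sum => i; apply: derivableZ; exact: derivable_bernstein.
Qed.

Lemma bernstein_comb_tr (R : realType) (m n : nat)
    (c : 'M[R]_(m.+1, n.+1)) (xi eta : R) :
  bernstein_comb c^T eta xi = bernstein_comb c xi eta.
Proof.
rewrite /bernstein_comb exchange_big; apply: eq_bigr => i _.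
by apply: eq_bigr => j _; rewrite mxE [bernstein _ _ eta * _]mulrC.
Qed.

(** Transposing the coefficients exchanges the two variables. *)
Lemma derivable_bernstein_comb_eta (R : realType) (m n : nat)
    (c : 'M[R]_(m.+1, n.+1)) (xi eta : R) :
  derivable (fun t => bernstein_comb c xi t) eta 1.
Proof.
under eq_fun do rewrite -bernstein_comb_tr.
exact: derivable_bernstein_comb_xi.
Qed.

Lemma bernstein_vcomb_coord (R : realType) (m n : nat)
    (c : 'I_m.+1 -> 'I_n.+1 -> 'cV[R]_3) (xi eta : R) (k : 'I_3) (l : 'I_1) :
  bernstein_vcomb c xi eta k l
    = bernstein_comb (\matrix_(i, j) c i j k l) xi eta.
Proof.
rewrite summxE; apply: eq_bigr => i _; rewrite summxE; apply: eq_bigr => j _.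
by rewrite !mxE mulrC.
Qed.

Lemma derivable_bernstein_vcomb_xi (R : realType) (m n : nat)
    (c : 'I_m.+1 -> 'I_n.+1 -> 'cV[R]_3) (xi eta : R) :
  derivable (fun t => bernstein_vcomb c t eta) xi 1.
Proof.
apply/derivable_mxP => k l; under eq_fun do rewrite bernstein_vcomb_coord.
exact: derivable_bernstein_comb_xi.
Qed.

Lemma derivable_bernstein_vcomb_eta (R : realType) (m n : nat)
    (c : 'I_m.+1 -> 'I_n.+1 -> 'cV[R]_3) (xi eta : R) :
  derivable (fun t => bernstein_vcomb c xi t) eta 1.
Proof.
apply/derivable_mxP => k l; under eq_fun do rewrite bernstein_vcomb_coord.
exact: derivable_bernstein_comb_eta.
Qed.

(** * The Gram determinant of a rational map *)

Lemma is_derive_quotient (R : realType) (f W : R -> R) (t : R) :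
  derivable f t 1 -> derivable W t 1 -> W t != 0 ->
  is_derive t 1 (fun s => (W s)^-1 * f s)
    (W t ^- 2 * (W t * 'D_1 f t - 'D_1 W t * f t)).
Proof.
move=> df dW Wt0.
have dV : derivable (fun s => (W s)^-1) t 1 by exact: derivableV.
apply: DeriveDef; first exact: (derivableM dV df).
rewrite (deriveM dV df) deriveV // /GRing.scale /=.
by field.
Qed.

(** The derivative of a matrix-valued function is taken entry by entry, which
    reduces the statement to real quotients. *)
Lemma derive1_rational (R : realType) (m n : nat)
    (F : R -> 'M[R]_(m.+1, n.+1)) (W : R -> R) (t : R) :
  derivable F t 1 -> derivable W t 1 -> W t != 0 ->
  derive1 (fun s => (W s)^-1 *: F s) t
    = W t ^- 2 *: (W t *: derive1 F t - derive1 W t *: F t).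
Proof.
move=> dF dW Wt0.
have dWFkl k l := is_derive_quotient ((derivable_mxP F t 1).1 dF k l) dW Wt0.
have coordE k l :
    (fun s => ((W s)^-1 *: F s) k l) = (fun s => (W s)^-1 * F s k l).
  by apply/funext => s; rewrite mxE.
have dWF : derivable (fun s => (W s)^-1 *: F s) t 1.
  by apply/derivable_mxP => k l; rewrite coordE; case: (dWFkl k l).
rewrite !derive1E (derive_mx dWF) (derive_mx dF); apply/matrixP => k l.
by rewrite !mxE coordE; case: (dWFkl k l).
Qed.

Lemma det_mx22 (R : comNzRingType) (A : 'M[R]_(1 + 1)) :
  \det A = A ord0 ord0 * A ord_max ord_max - A ord0 ord_max * A ord_max ord0.
Proof.
rewrite (expand_det_row A ord0) !big_ord_recl big_ord0 addr0 /cofactor.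
rewrite !det_mx11 !mxE expr0 expr1 mul1r mulN1r mulrN.
by congr (_ * A _ _ - A _ _ * A _ _); apply/val_inj.
Qed.

Lemma gram_row_mx (R : realType) (u v : 'cV[R]_3) :
  \det ((row_mx u v)^T *m row_mx u v) = dot u u * dot v v - dot u v ^+ 2.
Proof.
have dotE (a b : 'cV[R]_3) : (a^T *m b) 0 0 = dot a b.
  by rewrite mxE; apply: eq_bigr => k _; rewrite mxE.
have dotC : dot v u = dot u v by apply: eq_bigr => k _; rewrite mulrC.
rewrite tr_row_mx mul_col_row det_mx22.
have -> : ord0 = lshift 1 0 :> 'I_(1 + 1) by exact/val_inj.
have -> : ord_max = rshift 1 0 :> 'I_(1 + 1) by exact/val_inj.
by rewrite block_mxEul block_mxEdr block_mxEur block_mxEdl !dotE dotC.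
Qed.

Lemma gram_det_rational (R : realType) (F : R -> R -> 'cV[R]_3)
    (W : R -> R -> R) (xi eta : R) :
  derivable (F^~ eta) xi 1 -> derivable (F xi) eta 1 ->
  derivable (W^~ eta) xi 1 -> derivable (W xi) eta 1 -> W xi eta != 0 ->
  gram_det (rational_map F W) xi eta
    = W xi eta ^- 8 * gram_numerator F W xi eta.
Proof.
move=> dF1 dF2 dW1 dW2 W0; rewrite /gram_det /jacobian_mx gram_row_mx.
have dotZ a b (u v : 'cV[R]_3) : dot (a *: u) (b *: v) = a * b * dot u v.
  rewrite /dot mulr_sumr; apply: eq_bigr => k _; rewrite !mxE; ring.
have -> : partial_xi (rational_map F W) xi eta
    = W xi eta ^- 2 *: gram_U F W xi eta.
  exact: (derive1_rational dF1 dW1 W0).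
have -> : partial_eta (rational_map F W) xi eta
    = W xi eta ^- 2 *: gram_V F W xi eta.
  exact: (derive1_rational dF2 dW2 W0).
have -> : W xi eta ^- 8 = (W xi eta ^- 2) ^+ 4 by rewrite exprVn -exprM.
rewrite /gram_numerator.
(* The identity holds for any two vectors and any common factor. *)
move: (W xi eta ^- 2) (gram_U F W xi eta) (gram_V F W xi eta) => a U V.
by rewrite !dotZ; ring.
Qed.

(** The rank of [J^T *m J] bounds that of [J] from below, and the number of
    columns bounds it from above. *)
Lemma rank_gram (F : fieldType) (m n : nat) (J : 'M[F]_(m, n)) :
  \det (J^T *m J) != 0 -> \rank J = n.
Proof.
move=> det_neq0; apply/eqP; rewrite eqn_leq rank_leq_col /=.
have /mxrank_unit rank_JTJ : J^T *m J \in unitmx by rewrite unitmxE unitfE.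
by rewrite -[leqLHS]rank_JTJ mxrankM_maxr.
Qed.

Theorem theorem3p5 (R : realType) (p q : nat) (hp : (1 <= p)%N) (hq : (1 <= q)%N)
    (f : 'I_p.+1 -> 'I_q.+1 -> 'cV[R]_3) (w : 'M[R]_(p.+1, q.+1))
    (D : 'M[R]_((8 * p - 2).+1, (8 * q - 2).+1)) :
  let F := bernstein_vcomb f in
  let W := bernstein_comb w in
  let x := rational_map F W in
  (forall xi eta : R, xi \in `[0, 1] -> eta \in `[0, 1] -> 0 < W xi eta) ->
  bernstein_coefs (gram_numerator F W) D ->
  (forall r s, 0 <= D r s) ->
  (exists r s, 0 < D r s) ->
  (forall xi eta : R, xi \in `]0, 1[ -> eta \in `]0, 1[ -> 0 < gram_det x xi eta) /\
  regular_on (`]0, 1[ `*` `]0, 1[) x.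
Proof.
move=> F W x W_gt0 coefsD D_ge0 D_gt0.
have gram_gt0 xi eta : xi \in `]0, 1[ -> eta \in `]0, 1[ ->
    0 < gram_det x xi eta.
  move=> xi01 eta01.
  have xi01c := subset_itv_oo_cc xi01; have eta01c := subset_itv_oo_cc eta01.
  rewrite gram_det_rational ?gt_eqF ?W_gt0 //.
  - rewrite mulr_gt0 ?invr_gt0 ?exprn_gt0 ?W_gt0 // coefsD //.
    by rewrite bernstein_comb_gt0 // -in_itv.
  - exact: derivable_bernstein_vcomb_xi.
  - exact: derivable_bernstein_vcomb_eta.
  - exact: derivable_bernstein_comb_xi.
  - exact: derivable_bernstein_comb_eta.
split=> // -[xi eta] /= [xi01 eta01].
by apply: (@rank_gram _ 3 2); rewrite gt_eqF //; exact: gram_gt0.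
Qed.
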